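(* Let $R$ be a ring with identity such that the directed graph $\mathrm{APOG}(R)$ has at least one vertex. Then $R$ is Artinian (respectively, Noetherian) if and only if there is a left or right ideal $I$ of $R$ that is a vertex of $\mathrm{APOG}(R)$ such that $\mathrm{adu}(I)$ has DCC (respectively, ACC) on both its left ideals and its right ideals.
   Context: Rings are associative, not necessarily commutative. Artinian (Noetherian) means both left and right Artinian (Noetherian). $\mathrm{IPO}(R)$ is the set of all $A\subseteq R$ of the form $A=IJ$ where each of $I,J$ is a left or a right ideal of $R$; the product of additive subgroups is the set of finite sums of products. $\mathrm{IPO}(R)$ is a semigroup with zero $\{0\}$ under this product. $\mathrm{APOG}(R)$ is the directed graph whose vertices are the nonzero $A\in\mathrm{IPO}(R)$ for which there is a nonzero $B\in\mathrm{IPO}(R)$ with $AB=0$ or $BA=0$, with a directed edge $A\rightarrow B$ if $AB=0$. Write $A\rightleftharpoons B$ if $A\rightarrow B$ or $B\rightarrow A$. For a vertex $C$, let $$\mathrm{ad}(C)=\{A \text{ a vertex of } \mathrm{APOG}(R) : C=A,\text{ or } C\rightleftharpoons A,\text{ or there is a vertex } B \text{ with } C\rightleftharpoons B\rightleftharpoons A\},$$ and for a vertex $D$ let $\mathrm{adu}(D)=\bigcup_{C\subseteq D}\mathrm{ad}(C)$, the union over all vertices $C$ of $\mathrm{APOG}(R)$ with $C\subseteq D$. ''$\mathrm{adu}(I)$ has DCC (ACC) on both its left and right ideals'' means: the set of members of $\mathrm{adu}(I)$ that are left ideals of $R$ satisfies the descending (ascending) chain condition under inclusion, and so does the set of members that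 are right ideals of $R$. *)

(* Defs.v *)
From mathcomp Require Import all_boot all_order all_algebra.
From mathcomp Require Import boolp classical_sets.

Set Implicit Arguments.
Unset Strict Implicit.
Unset Printing Implicit Defensive.

Import GRing.Theory.
Local Open Scope classical_set_scope.
Local Open Scope ring_scope.

Definition additive_subgroup (R : pzRingType) (A : set R) : Prop :=
  A 0 /\ forall x y : R, A x -> A y -> A (x - y).

Definition left_ideal (R : pzRingType) (A : set R) : Prop :=
  additive_subgroup A /\ forall r x : R, A x -> A (r * x).

Definition right_ideal (R : pzRingType) (A : set R) : Prop :=
  additive_subgroup A /\ forall r x : R, A x -> A (x * r).

Definition one_sided_ideal (R : pzRingType) (A : set R) : Prop :=
  left_ideal A \/ right_ideal A.

(* Finite sums of products, not the elementwise product of two sets. *)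
Definition sprod (R : pzRingType) (A B : set R) : set R :=
  [set x | exists (n : nat) (a b : 'I_n -> R),
     [/\ forall i, A (a i), forall i, B (b i) & x = \sum_(i < n) a i * b i]].

Definition IPO (R : pzRingType) : set (set R) :=
  [set A | exists I J : set R,
     [/\ one_sided_ideal I, one_sided_ideal J & A = sprod I J]].

(* The edge relation of APOG(R) is the restriction of [arrow] to vertices. *)
Definition arrow (R : pzRingType) (A B : set R) : Prop :=
  sprod A B = [set 0].

Definition adjacent (R : pzRingType) (A B : set R) : Prop :=
  arrow A B \/ arrow B A.

Definition APOG_vertex (R : pzRingType) : set (set R) :=
  [set A | [/\ IPO A, A <> [set 0] &
     exists B : set R, [/\ IPO B, B <> [set 0] & adjacent A B]]].

Definition ad (R : pzRingType) (C : set R) : set (set R) :=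
  [set A | APOG_vertex A /\
     [\/ C = A, adjacent C A |
         exists B : set R, [/\ APOG_vertex B, adjacent C B & adjacent B A]]].

Definition adu (R : pzRingType) (D : set R) : set (set R) :=
  \bigcup_(C in [set C | APOG_vertex C /\ C `<=` D]) ad C.

Definition DCC (T : Type) (F : set (set T)) : Prop :=
  forall u : nat -> set T,
    (forall n, F (u n)) -> (forall n, u n.+1 `<=` u n) ->
    exists N : nat, forall n, (N <= n)%N -> u n = u N.

Definition ACC (T : Type) (F : set (set T)) : Prop :=
  forall u : nat -> set T,
    (forall n, F (u n)) -> (forall n, u n `<=` u n.+1) ->
    exists N : nat, forall n, (N <= n)%N -> u n = u N.

Definition artinian (R : pzRingType) : Prop :=
  DCC (@left_ideal R) /\ DCC (@right_ideal R).

Definition noetherian (R : pzRingType) : Prop :=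
  ACC (@left_ideal R) /\ ACC (@right_ideal R).

(* Main.v *)
Require Import Defs.
From mathcomp Require Import all_boot all_order all_algebra.
From mathcomp Require Import boolp classical_sets.

(** A one-sided ideal that is a vertex exists as soon as any vertex does: if [(I J)(K L) = 0] with [I J] and [K L]
    nonzero, then either [I J K] is nonzero, and it annihilates [L], or it is
    zero, and then [I J] annihilates [K]; so [L] or [K] is a vertex
    ([one_sided_vertex]).  The chain conditions on [adu] are inherited from
    those on all one-sided ideals.

    Conversely, let [I] be a left ideal and a vertex.  For an element [x], the
    left module [R] is an extension of [R x] by the left annihilator of [x],
    and a chain condition passes from these two submodules to [R]
    ([chain_condition_left]); likewise on the right.  So it is enough to find
    nonzero elements [x] for which all nonzero one-sided ideals inside these
    pieces belong to [adu I].

    - Annihilators, with any [x <> 0].  If [L x = 0] for a left ideal [L], then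
      [L] is adjacent to [(x R) I], which lies in [I]; if that product vanishes,
      [I], [x R], [L] is a path ([adu_left_annihilator]).  If [x K = 0] for a
      right ideal [K], then [K I], [R x], [K] is a path starting inside [I]; if
      [K I] vanishes, [K] is adjacent to [I] ([adu_right_annihilator]).
    - Left ideals inside [R x], with [x] in [I]: every nonzero element of
      [IPO R] inside the vertex [I] is itself a vertex ([adu_sub]).
    - Right ideals [K] inside [x R], with [I x = 0] or [x I = 0]: here
      [I K = 0] or [K I = 0].  Such an [x] exists because [I] is a vertex.

    The case of a right ideal [I] is the same statement over the converse ring,
    which reverses all arrows, and so has the same sets [adu], and exchanges
    left and right ideals. *)

Set Implicit Arguments.
Unset Strict Implicit.
Unset Printing Implicit Defensive.

Import GRing.Theory.
Local Open Scope classical_set_scope.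
Local Open Scope ring_scope.

(** * Chain conditions *)

(** The direction is a parameter so that DCC ([up = false]) and ACC
    ([up = true]) are instances, by conversion, of a single notion. *)
Definition chain_condition (up : bool) (T : Type) (F : set (set T)) : Prop :=
  forall u : nat -> set T,
    (forall n, F (u n)) ->
    (forall n, if up then u n `<=` u n.+1 else u n.+1 `<=` u n) ->
    exists N : nat, forall n, (N <= n)%N -> u n = u N.

Lemma chain_monotone (up : bool) (T : Type) (u : nat -> set T) :
  (forall n, if up then u n `<=` u n.+1 else u n.+1 `<=` u n) ->
  forall m n, (m <= n)%N -> if up then u m `<=` u n else u n `<=` u m.
Proof.
move=> hu m n /subnK <-; elim: (n - m)%N => [|k IHk]; first by case: up {hu}.
rewrite addSn; have := hu (k + m)%N; case: up IHk {hu} => h1 h2.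
  exact: subset_trans h2.
exact: subset_trans h1.
Qed.

(** One exceptional set [Z] never matters: a chain that leaves [Z] for good is
    a chain of [G] up to a shift, and a chain that meets [Z] infinitely often
    is constant from the first such time on, by antisymmetry. *)
Lemma chain_condition_except (up : bool) (T : Type) (Z : set T)
    (F G : set (set T)) :
  (forall A, F A -> A <> Z -> G A) ->
  chain_condition up G -> chain_condition up F.
Proof.
move=> FG ccG u Fu hu; have mono := chain_monotone hu.
have [[M hM]|often] :=
    pselect (exists M, forall n, (M <= n)%N -> u n <> Z).
  have [||N hN] := ccG (fun n => u (n + M)%N).
  - by move=> n; apply: FG (Fu _) (hM _ (leq_addl _ _)).
  - by move=> n; apply: hu.
  exists (N + M)%N => n le_n.
  have leMn : (M <= n)%N := leq_trans (leq_addl N M) le_n.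
  by rewrite -(subnK leMn) hN // -(leq_add2r M) subnK.
have oftenZ m : exists2 n, (m <= n)%N & u n = Z.
  apply: contrapT => never; apply: often; exists m => n le_mn un.
  by apply: never; exists n.
have [N _ uN] := oftenZ 0%N; exists N => n le_Nn.
have [p le_np up_] := oftenZ n; rewrite uN.
have := mono _ _ le_Nn; have := mono _ _ le_np; rewrite uN up_.
by case: (up) => h1 h2; apply/seteqP.
Qed.

(** The module-theoretic core: comparable subgroups with the same image under
    an additive map and the same intersection with its kernel are equal. *)
Lemma additive_subgroup_eq (R : pzRingType) (f : R -> R) (A B : set R) :
  (forall x y, f (x - y) = f x - f y) ->
  additive_subgroup A -> additive_subgroup B -> A `<=` B ->
  A `&` [set x | f x = 0] = B `&` [set x | f x = 0] -> f @` A = f @` B ->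
  A = B.
Proof.
move=> fB [A0 AB] [B0 BB] sAB eqK eqI; apply/seteqP; split=> // b Bb.
have [a Aa fab] : (f @` A) (f b) by rewrite eqI; exists b.
have [Ad _] : (A `&` [set x | f x = 0]) (b - a).
  by rewrite eqK; split; [apply: BB (sAB _ Aa) | rewrite /= fB fab subrr].
have AN : A (- a) by rewrite -[- a]add0r; apply: AB.
by rewrite -[b](subrK a) -[a]opprK; apply: AB; rewrite ?opprK.
Qed.

Lemma chain_condition_extension (R : pzRingType) (up : bool)
    (P : set (set R)) (f : R -> R) :
  (forall x y, f (x - y) = f x - f y) ->
  (forall A, P A -> additive_subgroup A) ->
  (forall A, P A -> P (A `&` [set x | f x = 0])) ->
  (forall A, P A -> P (f @` A)) ->
  chain_condition up (P `&` [set A | A `<=` [set x | f x = 0]]) ->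
  chain_condition up (P `&` [set A | A `<=` range f]) ->
  chain_condition up P.
Proof.
move=> fB Psub Pker Pim ccK ccI u Pu hu.
have [||M hM] := ccK (fun n => u n `&` [set x | f x = 0]).
- by move=> n; split; [apply: Pker | apply: subIsetr].
- by move=> n; have := hu n; case: (up); apply: setSI.
have [||N hN] := ccI (fun n => f @` u n).
- by move=> n; split; [apply: Pim | apply: image_subset].
- by move=> n; have := hu n; case: (up); apply: image_subset.
exists (maxn M N) => n le_n.
have /andP[le_Mn le_Nn] : (M <= n)%N && (N <= n)%N by rewrite -geq_max.
have eqK : u n `&` [set x | f x = 0] = u (maxn M N) `&` [set x | f x = 0].
  by rewrite hM // hM // leq_maxl.
have eqI : f @` u n = f @` u (maxn M N) by rewrite hN // hN // leq_maxr.
have := chain_monotone hu le_n; case: (up) => le_u; [apply/esym|];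
  by apply: (additive_subgroup_eq fB); rewrite ?eqK ?eqI; try exact: Psub.
Qed.

(** * One-sided ideals and their products *)

Section Products.
Variable R : pzRingType.
Implicit Types (A B C I J K L : set R) (x y : R).

Lemma additive_subgroupD A x y :
  additive_subgroup A -> A x -> A y -> A (x + y).
Proof.
move=> [A0 AB] Ax Ay; rewrite -[y]opprK; apply: (AB) => //.
by rewrite -[- y]add0r; apply: AB.
Qed.

Lemma nonzero_elt A : A 0 -> A <> [set 0] -> exists2 x, A x & x <> 0.
Proof.
move=> A0 nzA; apply: contrapT => no; apply: nzA; apply/seteqP.
by split=> [x Ax|x ->//]; apply: contrapT => nzx; apply: no; exists x.
Qed.

Lemma neq_set0 A x : A x -> x <> 0 -> A <> [set 0].
Proof. by move=> Ax nzx A0; apply: nzx; move: Ax; rewrite A0. Qed.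

Lemma sprod_mul A B a b : A a -> B b -> sprod A B (a * b).
Proof.
by move=> Aa Bb; exists 1%N, (fun=> a), (fun=> b); rewrite big_ord1.
Qed.

Lemma sprod0 A B : sprod A B 0.
Proof.
by exists 0%N, (fun=> 0), (fun=> 0); rewrite big_ord0; split=> // -[].
Qed.

Lemma sprodD A B x y : sprod A B x -> sprod A B y -> sprod A B (x + y).
Proof.
move=> [m [a [b [Aa Bb ->]]]] [n [c [d [Ac Bd ->]]]].
exists (m + n)%N,
  (fun i => match split i with inl j => a j | inr k => c k end),
  (fun i => match split i with inl j => b j | inr k => d k end).
split=> [i|i|]; try by case: (split i).
rewrite big_split_ord /=; congr (_ + _); apply: eq_bigr => i _.
  by rewrite (unsplitK (inl _ i)).
by rewrite (unsplitK (inr _ i)).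
Qed.

Lemma sprod_sub A B C :
  C 0 -> (forall x y, C x -> C y -> C (x + y)) ->
  (forall a b, A a -> B b -> C (a * b)) -> sprod A B `<=` C.
Proof.
move=> C0 CD CM _ [n [a [b [Aa Bb ->]]]].
by apply: big_ind => // i _; apply: CM.
Qed.

Lemma sprodA A B C : sprod (sprod A B) C = sprod A (sprod B C).
Proof.
apply/seteqP; split; apply: sprod_sub => [|x y|a b ha hb];
  try exact: sprod0; try exact: sprodD.
  move: a ha; apply: sprod_sub => [|x y /= hx hy|a b' Aa Bb] /=.
  - by rewrite mul0r; apply: sprod0.
  - by rewrite mulrDl; apply: sprodD.
  - by rewrite -mulrA; apply: sprod_mul => //; apply: sprod_mul.
move: b hb; apply: sprod_sub => [|x y /= hx hy|b c Bb Cc] /=.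
- by rewrite mulr0; apply: sprod0.
- by rewrite mulrDr; apply: sprodD.
- by rewrite mulrA; apply: sprod_mul => //; apply: sprod_mul.
Qed.

Lemma arrowP A B : arrow A B <-> forall a b, A a -> B b -> a * b = 0.
Proof.
split=> [AB0 a b Aa Bb|AB0].
  by have : sprod A B (a * b); [apply: sprod_mul | rewrite AB0].
apply/seteqP; split=> [|x ->]; last exact: sprod0.
by apply: sprod_sub => [//|x y -> ->|]; rewrite /= ?addr0.
Qed.

Lemma sprod_left_ideal I J : left_ideal I -> left_ideal (sprod I J).
Proof.
move=> [_ IM].
have RM r x : sprod I J x -> sprod I J (r * x).
  move: x; apply: sprod_sub => [|x y /= hx hy|a b Ia Jb] /=.
  - by rewrite mulr0; apply: sprod0.
  - by rewrite mulrDr; apply: sprodD.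
  - by rewrite mulrA; apply: sprod_mul => //; apply: IM.
split=> //; split=> [|x y hx hy]; first exact: sprod0.
by apply: sprodD => //; rewrite -mulN1r; apply: RM.
Qed.

Lemma sprod_right_ideal I J : right_ideal J -> right_ideal (sprod I J).
Proof.
move=> [_ JM].
have RM r x : sprod I J x -> sprod I J (x * r).
  move: x; apply: sprod_sub => [|x y /= hx hy|a b Ia Jb] /=.
  - by rewrite mul0r; apply: sprod0.
  - by rewrite mulrDl; apply: sprodD.
  - by rewrite -mulrA; apply: sprod_mul => //; apply: JM.
split=> //; split=> [|x y hx hy]; first exact: sprod0.
by apply: sprodD => //; rewrite -mulrN1; apply: RM.
Qed.

Lemma sprod_IPO I J :
  one_sided_ideal I -> one_sided_ideal J -> IPO (sprod I J).
Proof. by move=> hI hJ; exists I, J. Qed.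

(** Multiplying by the unit ideal on the side where [I] absorbs. *)
Lemma one_sided_ideal_IPO I : one_sided_ideal I -> IPO I.
Proof.
have idT : one_sided_ideal [set: R] by left.
move=> hI; case: (hI) => -[subI IM]; [exists setT, I | exists I, setT];
  split=> //; apply/seteqP; split.
- by move=> x Ix; rewrite -[x]mul1r; apply: sprod_mul.
- apply: sprod_sub => [|x y|a b _ Ib]; [by case: subI| |exact: IM].
  exact: additive_subgroupD.
- by move=> x Ix; rewrite -[x]mulr1; apply: sprod_mul.
- apply: sprod_sub => [|x y|a b Ia _]; [by case: subI| |exact: IM].
  exact: additive_subgroupD.
Qed.

(** The middle factor decides the bracketing: a right ideal [J] makes [I J] a
    right ideal, and a left ideal [J] makes [J K] a left ideal. *)
Lemma sprod3_IPO I J K :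
  one_sided_ideal I -> one_sided_ideal J -> one_sided_ideal K ->
  IPO (sprod (sprod I J) K).
Proof.
move=> hI [hJ|hJ] hK.
  by rewrite sprodA; apply: sprod_IPO => //; left; apply: sprod_left_ideal.
by apply: sprod_IPO => //; right; apply: sprod_right_ideal.
Qed.

Lemma left_ideal_mulr L x :
  left_ideal L -> left_ideal [set r * x | r in L].
Proof.
move=> [[L0 LB] LM]; split; first split.
- by exists 0; rewrite ?mul0r.
- move=> _ _ [a La <-] [b Lb <-]; exists (a - b); first exact: LB.
  by rewrite mulrBl.
by move=> r _ [a La <-]; exists (r * a); [apply: LM | rewrite mulrA].
Qed.

Lemma left_ideal_annihilator L x :
  left_ideal L -> left_ideal (L `&` [set r | r * x = 0]).
Proof.
move=> [[L0 LB] LM]; split; first split.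
- by split=> //=; rewrite mul0r.
- move=> a b [La /= ax] [Lb /= bx]; split; first exact: LB.
  by rewrite /= mulrBl ax bx subrr.
by move=> r a [La /= ax]; split; [apply: LM | rewrite /= -mulrA ax mulr0].
Qed.

(** [R x] is isomorphic to [R] modulo the left annihilator of [x]. *)
Lemma chain_condition_left (up : bool) x :
  chain_condition up (@left_ideal R `&` [set L | L `<=` [set r | r * x = 0]]) ->
  chain_condition up (@left_ideal R `&` [set L | L `<=` range ( *%R^~ x)]) ->
  chain_condition up (@left_ideal R).
Proof.
apply: chain_condition_extension => [a b|A []//|A|A].
- exact: mulrBl.
- exact: left_ideal_annihilator.
- exact: left_ideal_mulr.
Qed.

Lemma left_ideal_principal x : left_ideal (range ( *%R^~ x)).
Proof. exact: left_ideal_mulr. Qed.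

Lemma principal_left_nonzero x : x <> 0 -> range ( *%R^~ x) <> [set 0].
Proof. by apply: neq_set0; exists 1; rewrite ?mul1r. Qed.

(** * Vertices of the graph and the sets [adu] *)

Lemma adjacentC A B : adjacent A B -> adjacent B A.
Proof. by case; [right | left]. Qed.

Lemma adjacent_vertex A B :
  IPO A -> A <> [set 0] -> IPO B -> B <> [set 0] -> adjacent A B ->
  APOG_vertex A.
Proof. by move=> hA nzA hB nzB AB; split=> //; exists B. Qed.

Lemma one_sided_vertex :
  (exists A, @APOG_vertex R A) ->
  exists2 I, one_sided_ideal I & @APOG_vertex R I.
Proof.
suff main A B : IPO A -> A <> [set 0] -> IPO B -> B <> [set 0] -> arrow A B ->
    exists2 I, one_sided_ideal I & @APOG_vertex R I.
  by move=> [A [hA nzA [B [hB nzB [|]]]]]; apply: main.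
move=> hA nzA [K [L [hK hL ->]]] nzKL; rewrite /arrow -sprodA => AKL0.
have [I [J [hI hJ defA]]] := hA.
have nz (X Y : set R) : ~ arrow X Y -> X <> [set 0] /\ Y <> [set 0].
  by move=> nzXY; split=> h; apply: nzXY; rewrite h;
    apply/arrowP => a b;
    [move=> -> _; rewrite mul0r | move=> _ ->; rewrite mulr0].
have [nzK nzL] := nz _ _ nzKL.
have [AK0|nzAK] := pselect (sprod A K = [set 0]).
  exists K => //; apply: (@adjacent_vertex K A) => //; last by right.
  exact: one_sided_ideal_IPO.
exists L => //; apply: (@adjacent_vertex L (sprod A K)) => //; last by right.
  exact: one_sided_ideal_IPO.
by rewrite defA; apply: sprod3_IPO.
Qed.

Lemma adu_adjacent D C A :
  C `<=` D -> IPO C -> C <> [set 0] -> IPO A -> A <> [set 0] ->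
  adjacent C A -> adu D A.
Proof.
move=> sCD hC nzC hA nzA CA; exists C.
  by split=> //; apply: adjacent_vertex CA.
split; first by apply: adjacent_vertex (adjacentC CA).
by apply: Or32.
Qed.

Lemma adu_path D C B A :
  C `<=` D -> IPO C -> C <> [set 0] -> IPO B -> B <> [set 0] ->
  IPO A -> A <> [set 0] -> adjacent C B -> adjacent B A -> adu D A.
Proof.
move=> sCD hC nzC hB nzB hA nzA CB BA; exists C.
  by split=> //; apply: adjacent_vertex CB.
split; first by apply: adjacent_vertex (adjacentC BA).
by apply: Or33; exists B; split=> //; apply: adjacent_vertex BA.
Qed.

(** Whatever annihilates a vertex annihilates everything inside it. *)
Lemma adu_sub D A :
  APOG_vertex D -> A `<=` D -> IPO A -> A <> [set 0] -> adu D A.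
Proof.
move=> [_ _ [B [hB nzB DB]]] sAD hA nzA.
have vA : APOG_vertex A.
  apply: adjacent_vertex hB nzB _ => //.
  case: DB => /arrowP DB; [left | right]; apply/arrowP => a b ha hb; apply: DB;
    by [|apply: sAD].
by exists A; split=> //; apply: Or31.
Qed.

End Products.

(** * Passage to the converse ring *)

Section Converse.
Variable R : pzRingType.
Implicit Types (A B I : set R).

Lemma sprod_converse A B : @sprod R^c A B = sprod B A.
Proof.
by apply/seteqP; split=> x [n [a [b [Aa Bb ->]]]]; exists n, b, a.
Qed.

Lemma one_sided_ideal_converse I :
  @one_sided_ideal R^c I = one_sided_ideal I.
Proof. by apply/propext; split; case; [right | left | right | left]. Qed.

Lemma IPO_converse : @IPO R^c = @IPO R.
Proof.
apply/seteqP; split=> A [I [J [hI hJ ->]]]; exists J, I.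
  by rewrite -!one_sided_ideal_converse sprod_converse.
by rewrite !one_sided_ideal_converse sprod_converse.
Qed.

Lemma adjacent_converse A B : @adjacent R^c A B = adjacent A B.
Proof.
rewrite /adjacent /arrow !sprod_converse.
by apply/propext; split=> -[]; [right | left | right | left].
Qed.

Lemma APOG_vertex_converse : @APOG_vertex R^c = @APOG_vertex R.
Proof.
apply/funext => A; rewrite /APOG_vertex /= IPO_converse.
apply/propext; split=> -[hA nzA [B [hB nzB AB]]]; split=> //; exists B;
  by split=> //; rewrite adjacent_converse in AB *.
Qed.

Lemma ad_converse A : @ad R^c A = ad A.
Proof.
rewrite /ad APOG_vertex_converse.
apply/funext => B /=; rewrite adjacent_converse.
congr (_ /\ or3 _ _ _); apply/propext.
by split=> -[C [hC AC CB]]; exists C; split=> //;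
  rewrite ?adjacent_converse // -adjacent_converse.
Qed.

Lemma adu_converse A : @adu R^c A = adu A.
Proof.
by rewrite /adu APOG_vertex_converse; apply: eq_bigcupr => C _;
  rewrite ad_converse.
Qed.

(* Right ideals are, by conversion, the left ideals of the converse ring. *)
Lemma right_ideal_principal (x : R) : right_ideal (range ( *%R x)).
Proof. exact: (@left_ideal_principal R^c). Qed.

Lemma principal_right_nonzero (x : R) : x <> 0 -> range ( *%R x) <> [set 0].
Proof. exact: (@principal_left_nonzero R^c). Qed.

Lemma chain_condition_right (up : bool) (x : R) :
  chain_condition up (@right_ideal R `&` [set K | K `<=` [set r | x * r = 0]]) ->
  chain_condition up (@right_ideal R `&` [set K | K `<=` range ( *%R x)]) ->
  chain_condition up (@right_ideal R).
Proof. exact: (@chain_condition_left R^c). Qed.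

End Converse.

(** * Chain conditions from a left ideal that is a vertex *)

Section LeftIdealVertex.
Variables (R : pzRingType) (I : set R).
Hypotheses (left_I : left_ideal I) (vertex_I : APOG_vertex I).

Let one_sided_I : one_sided_ideal I. Proof. by left. Qed.
Let IPO_I : IPO I. Proof. exact: one_sided_ideal_IPO. Qed.
Let nonzero_I : I <> [set 0]. Proof. by case: vertex_I. Qed.

Lemma sprod_sub_left (A : set R) : sprod A I `<=` I.
Proof.
case: left_I => subI IM; apply: sprod_sub => [|x y|a b _]; last exact: IM.
  by case: subI.
exact: additive_subgroupD.
Qed.

(** Through [(x R) I], a member of [IPO R] that sits inside [I] on account of
    its right factor and is annihilated by [L] on account of its left one. *)
Lemma adu_left_annihilator (x : R) (L : set R) :
  x <> 0 -> left_ideal L -> L <> [set 0] -> (forall a, L a -> a * x = 0) ->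
  adu I L.
Proof.
move=> nzx hL nzL Lx0.
have IPO_L : IPO L by apply: one_sided_ideal_IPO; left.
have hxR : one_sided_ideal (range ( *%R x)).
  by right; apply: right_ideal_principal.
have LxR : arrow L (range ( *%R x)).
  by apply/arrowP => a _ La [r _ <-]; rewrite mulrA Lx0 // mul0r.
have [xI0|nzxI] := pselect (sprod (range ( *%R x)) I = [set 0]).
  apply: (@adu_path _ I I (range ( *%R x)) L) => //; try by right.
    exact: one_sided_ideal_IPO.
  exact: principal_right_nonzero.
apply: (@adu_adjacent _ I (sprod (range ( *%R x)) I) L) => //.
- exact: sprod_sub_left.
- exact: sprod_IPO.
right; rewrite /arrow -sprodA LxR.
by apply/arrowP => a b -> _; rewrite mul0r.
Qed.

(** Through [K I], which is annihilated by [R x] because [K] is, and lies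
    inside [I]. *)
Lemma adu_right_annihilator (x : R) (K : set R) :
  x <> 0 -> right_ideal K -> K <> [set 0] -> (forall a, K a -> x * a = 0) ->
  adu I K.
Proof.
move=> nzx hK nzK xK0.
have sided_K : one_sided_ideal K by right.
have IPO_K : IPO K by apply: one_sided_ideal_IPO.
have RxK : arrow (range ( *%R^~ x)) K.
  by apply/arrowP => _ a [r _ <-] Ka; rewrite /= -mulrA xK0 // mulr0.
have [KI0|nzKI] := pselect (sprod K I = [set 0]).
  by apply: (@adu_adjacent _ I I K) => //; right.
apply: (@adu_path _ I (sprod K I) (range ( *%R^~ x)) K) => //.
- exact: sprod_sub_left.
- exact: sprod_IPO.
- by apply: one_sided_ideal_IPO; left; apply: left_ideal_principal.
- exact: principal_left_nonzero.
- right; rewrite /arrow -sprodA RxK.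
  by apply/arrowP => a b -> _; rewrite mul0r.
- by left.
Qed.

Lemma chain_condition_left_of_adu (up : bool) :
  chain_condition up (adu I `&` @left_ideal R) ->
  chain_condition up (@left_ideal R).
Proof.
move=> cc; have [x Ix nzx] := nonzero_elt left_I.1.1 nonzero_I.
apply: (@chain_condition_left _ up x);
  apply: (@chain_condition_except _ _ [set 0]) cc => L [hL sL] nzL; split=> //.
  exact: adu_left_annihilator hL nzL sL.
apply: adu_sub nzL => //; last by apply: one_sided_ideal_IPO; left.
by apply: subset_trans sL _ => _ [r _ <-]; apply: left_I.2.
Qed.

Lemma chain_condition_right_of_adu (up : bool) :
  chain_condition up (adu I `&` @right_ideal R) ->
  chain_condition up (@right_ideal R).
Proof.
move=> cc; have [_ _ [B [hB nzB IB]]] := vertex_I.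
have [x Bx nzx] : exists2 x, B x & x <> 0.
  by apply: nonzero_elt => //; have [J [K [_ _ ->]]] := hB; apply: sprod0.
apply: (@chain_condition_right _ up x);
  apply: (@chain_condition_except _ _ [set 0]) cc => K [hK sK] nzK; split=> //.
  exact: adu_right_annihilator hK nzK sK.
apply: (@adu_adjacent _ I I K) => //.
  by apply: one_sided_ideal_IPO; right.
case: IB => /arrowP IB; [left | right]; apply/arrowP.
  by move=> a _ Ia /sK[r _ <-]; rewrite mulrA (IB a x) // mul0r.
(* [I] absorbs [r], so that [x * r * a] falls under [B I = 0]. *)
by move=> _ a /sK[r _ <-] Ia; rewrite -mulrA IB //; apply: left_I.2.
Qed.

End LeftIdealVertex.

Lemma chain_condition_iff_adu (R : pzRingType) (up : bool) :
  (exists A : set R, APOG_vertex A) ->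
  (chain_condition up (@left_ideal R) /\ chain_condition up (@right_ideal R)) <->
  exists I : set R,
    [/\ one_sided_ideal I, APOG_vertex I,
        chain_condition up (adu I `&` @left_ideal R) &
        chain_condition up (adu I `&` @right_ideal R)].
Proof.
move=> hR; split=> [[ccl ccr]|[I [[hI|hI] vI ccl ccr]]].
- have [I hI vI] := one_sided_vertex hR; exists I; split=> //.
    by move=> u hu; apply: ccl => n; case: (hu n).
  by move=> u hu; apply: ccr => n; case: (hu n).
- by split; [apply: (chain_condition_left_of_adu hI) |
             apply: (chain_condition_right_of_adu hI)].
have vI' : @APOG_vertex R^c I by rewrite APOG_vertex_converse.
rewrite -adu_converse in ccl ccr; split.
  exact: (@chain_condition_right_of_adu R^c I hI vI' up ccl).
exact: (@chain_condition_left_of_adu R^c I hI vI' up ccr).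
Qed.

Theorem theorem2p7 (R : pzRingType)
    (hR : exists A : set R, APOG_vertex A) :
  (artinian R <->
     exists I : set R,
       [/\ one_sided_ideal I, APOG_vertex I,
           DCC (adu I `&` @left_ideal R) &
           DCC (adu I `&` @right_ideal R)])
  /\
  (noetherian R <->
     exists I : set R,
       [/\ one_sided_ideal I, APOG_vertex I,
           ACC (adu I `&` @left_ideal R) &
           ACC (adu I `&` @right_ideal R)]).
Proof.
split; first exact: (chain_condition_iff_adu false hR).
exact: (chain_condition_iff_adu true hR).
Qed.
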